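(* There is an absolute constant $b>0$ such that for every $k\ge1$ and every extended access graph $G$ whose underlying graph is a finite simple path labeled surjectively by exactly $k+1$ pages, $r_{\mathrm{MAXFAR}}(G,k)\le b\, r^\infty_{\mathsf{obl}}(G,k)$.
   Context: Paging with a cache of $k$ slots, initially empty; a fault occurs when a requested page is not in the cache, and it is brought in, evicting a page if the cache is full. $A(k,\sigma)$ is the number of faults and $\mathrm{OPT}(k,\sigma)$ the offline minimum. An extended access graph is a graph with vertices labeled by pages; its request sequences are label sequences of vertex walks in which consecutive vertices are equal or adjacent. $r_A(G,k)=\inf\{r: E[A(k,\sigma)]\le r\,\mathrm{OPT}(k,\sigma)\ \forall\sigma\}$ (strict ratio); $r^\infty_{\mathsf{obl}}(G,k)$ is the infimum over randomized online algorithms of the asymptotic ratio (same inequality with an additive constant $C\ge0$ allowed). Let $G=\langle v_1,\dots,v_m\rangle$ be a simple path with surjective labeling $\ell$ onto a set $\mathcal P$ of $k+1$ pages. For a vertex $v_i$, define $p\prec_i q$ if every path from $v_i$ to a vertex labeled $q$ contains a vertex labeled $p$; let $M_i$ be the set of $\prec_i$-maximal pages and $M_i'\subseteq M_i$ those pages appearing on both sides of $v_i$ in $G$. On $M_i'$ define the linear order $p\prec_i^L q$ if, walking from $v_i$ to the left, a vertex labeled $p$ is reached before one labeled $q$ (the analogous right order is its reverse). Phases: the request sequence is split into consecutive phases, each ending just before the request to its $(k+1)$-st distinct page (or at the end); a page is marked if requested in the current phase. Algorithm MAXFAR (which knows $G$ and the walk's vertices) is a marking algorithm (never evicts a marked page).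 If the current phase began at vertex $v_i$, on the $j$-th fault of the phase let $N_j\subseteq M_i$ be the set of unmarked $\prec_i$-maximal pages; evict a page of $N_j\cap M_i'$ in the middle of $N_j\cap M_i'$ with respect to $\prec_i^L$; if $N_j$ contains only pages appearing on one side of $v_i$, evict one of them. *)

(* Defs.v *)
From HB Require Import structures.
From mathcomp Require Import all_boot all_order all_algebra.
From mathcomp Require Import all_classical all_reals all_analysis.

Set Implicit Arguments.
Unset Strict Implicit.
Unset Printing Implicit Defensive.

Import Order.TTheory GRing.Theory Num.Theory.
Local Open Scope ring_scope.

(* A service is a list of pairs (requested page, page to evict); the second    *)
(* component is only used when the request is a fault on a full cache.         *)
Section Paging.
Variables (P : finType) (k : nat).
Implicit Types (C : {set P}) (s : seq (P * P)).

Definition serve C (pe : P * P) : {set P} :=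
  if pe.1 \in C then C
  else if (#|C| < k)%N then pe.1 |: C
  else pe.1 |: (C :\ pe.2).

Definition cache_after C s : {set P} := foldl serve C s.

Fixpoint nfaults C s : nat :=
  if s is pe :: s' then ((pe.1 \notin C) + nfaults (serve C pe) s')%N else 0%N.

Fixpoint valid_service C s : bool :=
  if s is pe :: s' then
    ((pe.1 \notin C) && (k <= #|C|)%N ==> (pe.2 \in C))
    && valid_service (serve C pe) s'
  else true.

(* The default value [size sigma] bounds every fault count, so it never        *)
(* lowers the minimum, which ranges over a nonempty set as soon as 0 < k.      *)
Definition OPT (sigma : seq P) : nat :=
  \big[minn/size sigma]_(ev : (size sigma).-tuple P
                         | valid_service finset.set0 (zip sigma ev))
    nfaults finset.set0 (zip sigma ev).

End Paging.

Record ext_access_graph (P : finType) := ExtAccessGraph {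
  vertex : finType;
  adj : rel vertex;
  adj_sym : symmetric adj;
  adj_irr : irreflexive adj;
  label : vertex -> P
}.

Definition path_adj (m : nat) : rel 'I_m :=
  fun i j => (i.+1 == j :> nat) || (j.+1 == i :> nat).

Lemma path_adj_sym m : symmetric (@path_adj m).
Proof. by move=> i j; rewrite /path_adj orbC. Qed.

Lemma path_adj_irr m : irreflexive (@path_adj m).
Proof. by move=> i; rewrite /path_adj orbb gtn_eqF. Qed.

Definition path_graph (P : finType) (m : nat) (lab : 'I_m -> P) :=
  ExtAccessGraph (@path_adj_sym m) (@path_adj_irr m) lab.

Section Algorithms.
Variables (P : finType) (G : ext_access_graph P) (k : nat).
Implicit Types (w : seq (vertex G)).

Definition is_walk w : bool := sorted (fun u v => (u == v) || adj u v) w.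

Definition requests w : seq P := map (@label P G) w.

(* A deterministic online algorithm maps the walk up to and including the      *)
(* current vertex to the page evicted at that vertex, should this be needed.   *)
(* No explicit state is required: the past walk determines the cache.          *)
Definition online_alg := seq (vertex G) -> P.

Definition service (A : online_alg) w : seq (P * P) :=
  zip (requests w) [seq A (take i.+1 w) | i <- iota 0 (size w)].

Definition valid_alg (A : online_alg) : Prop :=
  forall w, is_walk w -> valid_service k finset.set0 (service A w).

Definition alg_cache (A : online_alg) w : {set P} :=
  cache_after k finset.set0 (service A w).

Definition alg_faults (A : online_alg) w : nat :=
  nfaults k finset.set0 (service A w).

(* A randomized online algorithm is a random deterministic one. *)
Record rand_alg (R : realType) := RandAlg {
  rand_disp : measure_display;
  rand_space : measurableType rand_disp;
  rand_prob : probability rand_space R;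
  rand_run : rand_space -> online_alg;
  rand_valid : forall omega, valid_alg (rand_run omega);
  rand_meas : forall w p,
    measurable ([set omega | rand_run omega w = p]%classic : set rand_space)
}.

Definition rand_faults (R : realType) (A : rand_alg R) w : \bar R :=
  ('E_(rand_prob A) [fun omega => (alg_faults (@rand_run R A omega) w)%:R])%E.

(* The ratios are attached to the function giving the (expected) number of     *)
(* faults on each walk; the infimum of the empty set is +oo.                   *)
Definition strict_ratio (R : realType) (cost : seq (vertex G) -> \bar R)
    : \bar R :=
  ereal_inf [set r%:E | r in [set r : R | forall w, is_walk w ->
    (cost w <= (r * (OPT k (requests w))%:R)%:E)%E]]%classic.

Definition asymptotic_ratio (R : realType) (cost : seq (vertex G) -> \bar R)
    : \bar R :=
  ereal_inf [set r%:E | r in [set r : R | exists C : R, 0 <= C /\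
    forall w, is_walk w ->
    (cost w <= (r * (OPT k (requests w))%:R + C)%:E)%E]]%classic.

Definition r_det (R : realType) (A : online_alg) : \bar R :=
  strict_ratio (fun w => ((alg_faults A w)%:R : R)%:E).

Definition r_obl_infty (R : realType) : \bar R :=
  ereal_inf [set x : \bar R | exists A : rand_alg R,
                                x = asymptotic_ratio (rand_faults A)]%classic.

Definition phase_step (s : seq (vertex G)) (v : vertex G) : seq (vertex G) :=
  if (k < size (undup (requests (rcons s v))))%N then [:: v] else rcons s v.

Definition current_phase w : seq (vertex G) := foldl phase_step [::] w.

Definition prec (v : vertex G) (p q : P) : Prop :=
  forall s, path (@adj P G) v s -> uniq (v :: s) -> label (last v s) = q ->
  exists2 u, u \in v :: s & label u = p.

Definition prec_max (v : vertex G) : {set P} :=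
  [set p | `[< forall q, prec v p q -> q = p >]]%SET.

End Algorithms.

Section Maxfar.
Variables (P : finType) (m k : nat) (lab : 'I_m -> P).
Local Notation G := (path_graph lab).

Definition prec_max_two_sided (i : 'I_m) : {set P} :=
  [set p in @prec_max P G i |
    [exists j : 'I_m, (j < i)%N && (lab j == p)] &&
    [exists j : 'I_m, (i < j)%N && (lab j == p)]]%SET.

Definition left_before (i : 'I_m) (p q : P) : bool :=
  [exists j : 'I_m, [&& (j <= i)%N, lab j == p &
    [forall j' : 'I_m, (j <= j' <= i)%N ==> (lab j' != q)]]].

(* Both medians of a set of even cardinality are in the middle. *)
Definition in_middle (i : 'I_m) (S : {set P}) (e : P) : bool :=
  let before := #|[set q in S | left_before i q e]%SET| in
  let after := #|[set q in S | left_before i e q]%SET| in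
  [&& e \in S, (before <= after.+1)%N & (after <= before.+1)%N].

Definition maxfar_choice (i : 'I_m) (N : {set P}) (e : P) : bool :=
  let S := (N :&: prec_max_two_sided i)%SET in
  if S == finset.set0 then e \in N else in_middle i S e.

(* The choices left open by the rule (which median, which one-sided page) are  *)
(* arbitrary: [A] is MAXFAR for some way of making them.                       *)
Definition is_maxfar (A : online_alg G) : Prop :=
  valid_alg k A /\
  forall (w : seq 'I_m) (x : 'I_m), is_walk (rcons w x : seq (vertex G)) ->
    lab x \notin alg_cache k A w -> (k <= #|alg_cache k A w|)%N ->
    let phase : seq 'I_m := @current_phase P G k (rcons w x) in
    let i := head x phase in
    let N := [set p in @prec_max P G i | p \notin [seq lab v | v <- phase]]%SET in
    maxfar_choice i N (A (rcons w x)).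

End Maxfar.

(* Main.v *)
Require Import Defs.
From mathcomp Require Import all_boot all_order all_algebra.
From mathcomp Require Import all_classical all_reals all_analysis.
From mathcomp Require Import measurable_realfun zify lra.
Import Order.TTheory GRing.Theory Num.Theory.

Set Implicit Arguments.
Unset Strict Implicit.
Unset Printing Implicit Defensive.

(* With k + 1 pages a full cache misses exactly one page, the hole. Let n be the *)
(* largest number of two-sided maximal pages at a vertex.                        *)
(* - MAXFAR keeps its hole on an unmarked maximal page. When a two-sided hole is *)
(*   requested, all maximal pages on one side of it in the left order have been  *)
(*   visited, so the unmarked ones are halved; at most two maximal pages are     *)
(*   one-sided. Hence a phase costs at most log2 n + 4 faults, while OPT pays at *)
(*   least one per phase.                                                        *)
(* - Conversely, at a vertex with n two-sided maximal pages an adversary runs a  *)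
(*   binary search: it tours around the vertex avoiding one half of the remaining*)
(*   candidates. The two possible tours jointly request all pages, so one of     *)
(*   them costs any randomized algorithm 1/2 in expectation. A round of log2 n   *)
(*   steps avoids a single page altogether and so costs OPT at most one fault.   *)
(*   Thus every asymptotic ratio is at least (log2 n) / 2; it is also at least 1 *)
(*   because OPT is unbounded, and log2 n + 4 <= 6 max(1, (log2 n) / 2).         *)

(** Two facts carry the upper bound [maxfar_upper]. By [resets_nfaults], once a phase has ended,
    every valid service pays one fault per reset plus k for the first phase. This k absorbs the
    initial filling of the cache, so no additive constant remains. By [stage_fault], requesting a
    two-sided hole halves the unmarked two-sided candidates, and [one_sided_card] bounds what is
    left. The geometric core of the lower bound is [reach2_cover]. If the pages of T1 precede those
    of T2 in the left order at i, every page can be reached from i while avoiding T1 or while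
    avoiding T2. So the page missing from the cache is requested on one of two tours
    ([alg_faults_cover2]), and averaging gives an expected gain of 1/2 on one of them. [round]
    iterates this along a binary search, [rounds] repeats it n times, and letting n grow in
    [rand_ratio_ge] removes the additive constant. *)

Section Services.
Variables (P : finType) (k : nat).
Implicit Types (C : {set P}) (s : seq (P * P)).

Lemma nfaults_cat C s1 s2 :
  nfaults k C (s1 ++ s2) = nfaults k C s1 + nfaults k (cache_after k C s1) s2.
Proof. by elim: s1 C => //= pe s1 IH C; rewrite IH addnA. Qed.

Lemma valid_service_cat C s1 s2 :
  valid_service k C (s1 ++ s2) =
  valid_service k C s1 && valid_service k (cache_after k C s1) s2.
Proof. by elim: s1 C => //= pe s1 IH C; rewrite IH andbA. Qed.

Lemma cache_after_cat C s1 s2 :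
  cache_after k C (s1 ++ s2) = cache_after k (cache_after k C s1) s2.
Proof. exact: foldl_cat. Qed.

Lemma nfaults_rcons C s pe :
  nfaults k C (rcons s pe) = nfaults k C s + (pe.1 \notin cache_after k C s).
Proof. by rewrite -cats1 nfaults_cat /= addn0. Qed.

Lemma cache_after_rcons C s pe :
  cache_after k C (rcons s pe) = serve k (cache_after k C s) pe.
Proof. by rewrite -cats1 cache_after_cat. Qed.

Lemma nfaults_size C s : nfaults k C s <= size s.
Proof.
elim: s C => //= pe s IH C; rewrite -add1n leq_add ?IH //.
by case: (_ \notin _).
Qed.

Lemma mem_serve C pe : pe.1 \in serve k C pe.
Proof. by rewrite /serve; do 2?case: ifP => //; rewrite finset.setU11. Qed.

Lemma card_serve C pe : #|C| <= k ->
  (pe.1 \notin C) && (k <= #|C|) ==> (pe.2 \in C) -> #|serve k C pe| <= k.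
Proof.
rewrite /serve; case: ifP => //= pC Ck; case: ltnP => /= Hk.
  by move=> _; rewrite cardsU1 pC.
move=> eC; rewrite cardsU1 !inE pC andbF /=.
by have := cardsD1 pe.2 C; rewrite eC; lia.
Qed.

Lemma card_cache_after C s :
  valid_service k C s -> #|C| <= k -> #|cache_after k C s| <= k.
Proof.
by elim: s C => //= pe s IH C /andP[H1 H2] Ck; apply: IH => //; apply: card_serve.
Qed.

Lemma nfaults_gt0 C s p : p \notin C -> p \in unzip1 s -> 0 < nfaults k C s.
Proof.
elim: s C => //= pe s IH C pC; rewrite inE => /predU1P[<-|ps]; first by rewrite pC.
case: (boolP (pe.1 \in C)) => // peC.
by rewrite /serve peC; apply: IH.
Qed.

Lemma OPT_le s : valid_service k finset.set0 s ->
  OPT k (unzip1 s) <= nfaults k finset.set0 s.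
Proof.
move=> vs; have sz : size (unzip2 s) == size (unzip1 s) by rewrite !size_map.
rewrite /OPT -minEnat -leEnat.
by apply: (bigmin_inf (Tuple sz)); rewrite /= zip_unzip.
Qed.

(** The bound on n is needed because [size sigma] is the default value of the minimum. *)
Lemma OPT_ge (sigma : seq P) n : n <= size sigma ->
  (forall s, unzip1 s = sigma -> valid_service k finset.set0 s ->
     n <= nfaults k finset.set0 s) -> n <= OPT k sigma.
Proof.
move=> nsz H; rewrite /OPT; elim/big_ind: _ => // [x y nx ny|ev vev].
  by rewrite leq_min nx.
by apply: H => //; rewrite unzip1_zip // size_tuple.
Qed.

Lemma OPT_size (sigma : seq P) : OPT k sigma <= size sigma.
Proof.
rewrite /OPT; elim/big_rec: _ => // ev x _ xs.
by rewrite geq_min xs orbT.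
Qed.

Lemma exists_notin_small C : #|C| < #|P| -> exists p, p \notin C.
Proof.
move=> H; apply/existsP; apply: contraLR H; rewrite negb_exists -leqNgt => /forallP H.
by apply/subset_leq_card/fintype.subsetP => x _; move: (H x); rewrite negbK.
Qed.

(** After [s1] any cache misses some page, and [s2] requests it. *)
Lemma OPT_cat_cover (s1 s2 : seq P) : k < #|P| -> (forall p, p \in s2) ->
  OPT k s1 < OPT k (s1 ++ s2).
Proof.
move=> kP cov; apply: OPT_ge.
  rewrite size_cat -addn1 leq_add ?OPT_size //.
  case: s2 cov => // cov.
  by have /card_gt0P[p _] : 0 < #|P| := leq_trans (ltn0Sn _) kP; have := cov p.
move=> s es vs; pose n := size s1.
have e1 : unzip1 (take n s) = s1 by rewrite /unzip1 map_take -/(unzip1 _) es take_size_cat.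
have e2 : unzip1 (drop n s) = s2 by rewrite /unzip1 map_drop -/(unzip1 _) es drop_size_cat.
move: vs; rewrite -(cat_take_drop n s) valid_service_cat nfaults_cat -addn1.
move=> /andP[v1 v2]; apply: leq_add; first by rewrite -e1 OPT_le.
have [|p pC] := @exists_notin_small (cache_after k finset.set0 (take n s)).
  by apply: leq_ltn_trans kP; apply: card_cache_after; rewrite ?cards0.
by apply: (nfaults_gt0 pC); rewrite e2.
Qed.

(** All pages other than q fit in the cache together, so nothing is ever evicted and each fault
    enlarges the cache. *)
Lemma serve_avoiding C s q : #|P| = k.+1 -> C \subset [set~ q]%SET ->
  q \notin unzip1 s ->
  [/\ valid_service k C s, nfaults k C s + #|C| <= k &
      cache_after k C s = (C :|: [set p in unzip1 s])%SET].
Proof.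
move=> Pk; elim: s C => [|pe s IH] C /= Cq.
  have -> : ([set p in [::]] = finset.set0 :> {set P})%SET by apply/finset.setP => x; rewrite !inE.
  rewrite finset.setU0; split=> //.
  by have := subset_leq_card Cq; rewrite cardsC1 Pk.
rewrite inE negb_or => /andP[qp qs].
have Cq' : pe.1 |: C \subset [set~ q]%SET.
  by rewrite finset.subUset finset.sub1set !inE eq_sym qp.
have eU : (pe.1 |: C) :|: [set p in unzip1 s]%SET = C :|: [set p in pe.1 :: unzip1 s]%SET.
  by apply/finset.setP => x; rewrite !inE; do !case: (_ \in _) => //; case: eqP.
case: (boolP (pe.1 \in C)) => peC.
  rewrite /serve peC /=; have [-> -> ->] := IH _ Cq qs; split=> //.
  by rewrite -eU; congr (_ :|: _)%SET; apply/esym/finset.setUidPr; rewrite finset.sub1set.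
have Ck : #|C| < k.
  have := subset_leq_card Cq'; rewrite cardsC1 Pk cardsU1 peC.
  by rewrite add1n.
rewrite /serve (negbTE peC) Ck /= leqNgt Ck /=.
have [-> H ->] := IH _ Cq' qs; split=> //.
by rewrite cardsU1 peC in H; lia.
Qed.

(** The first request to the hole q, if there is one, evicts q'. From then on q' is the hole and is
    never requested. *)
Lemma serve_hole s q q' : #|P| = k.+1 ->
  q' \notin unzip1 s -> (q == q') || (q \in unzip1 s) -> {in s, forall pe, pe.2 = q'} ->
  [/\ valid_service k [set~ q]%SET s, nfaults k [set~ q]%SET s <= 1 &
      cache_after k [set~ q]%SET s = [set~ q']%SET].
Proof.
move=> Pk; have ck x : #|[set~ x]%SET : {set P}| = k by rewrite cardsC1 Pk.
elim: s => [|pe s IH] /=; first by rewrite orbF => _ /eqP ->.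
rewrite !inE negb_or => /andP[q'p q's] qin ev.
have ev' : {in s, forall pe, pe.2 = q'} by move=> x xs; apply: ev; rewrite inE xs orbT.
rewrite negbK /serve finset.in_setC1 ck ltnn leqnn andbT.
case: eqP => [epq|npq] /=; last first.
  by apply: IH => //; move: qin; rewrite (eq_sym q pe.1) => /or3P[->|/eqP/npq|->]; rewrite ?orbT.
rewrite (ev pe) ?mem_head // epq in q'p *; rewrite q'p /=.
have -> : (q |: [set~ q] :\ q' = [set~ q'])%SET.
  apply/finset.setP => x; rewrite !inE; case: (x =P q) => [->|] /=; last by rewrite andbT.
  by rewrite eq_sym q'p.
have [-> H ->] := serve_avoiding Pk (subxx [set~ q']%SET) q's.
split=> //; first by move: H; rewrite ck; lia.
apply/finset.setP => x; rewrite !inE; case: eqP => //= ->; exact/negbTE.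
Qed.
End Services.

(** * Online algorithms along growing walks *)

Section OnlineServices.
Variables (P : finType) (G : ext_access_graph P) (k : nat) (A : online_alg G).
Implicit Types (w u : seq (vertex G)).

Lemma service_rcons w x :
  service A (rcons w x) = rcons (service A w) (label x, A (rcons w x)).
Proof.
rewrite /service /requests map_rcons size_rcons -addn1 iotaD map_cat /= add0n cats1.
rewrite zip_rcons ?size_map ?size_iota // -(size_rcons w x) take_size.
congr (rcons (zip _ _) _); apply/eq_in_map => i; rewrite mem_iota add0n => /= iw.
by rewrite -cats1 takel_cat.
Qed.

Lemma service_cat w u :
  exists2 s, service A (w ++ u) = service A w ++ s & unzip1 s = requests u.
Proof.
elim/last_ind: u => [|u x [s es us]]; first by exists [::]; rewrite ?cats0.
exists (rcons s (label x, A (rcons (w ++ u) x))).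
  by rewrite -rcons_cat service_rcons es rcons_cat.
by rewrite /unzip1 map_rcons -/(unzip1 _) us /requests map_rcons.
Qed.

Lemma unzip1_service w : unzip1 (service A w) = requests w.
Proof. by have [s] := service_cat [::] w; rewrite cat0s => ->. Qed.

Lemma alg_faults_rcons w x : alg_faults k A (rcons w x) =
  alg_faults k A w + (label x \notin alg_cache k A w).
Proof. by rewrite /alg_faults service_rcons nfaults_rcons. Qed.

Lemma alg_cache_rcons w x :
  alg_cache k A (rcons w x) = serve k (alg_cache k A w) (label x, A (rcons w x)).
Proof. by rewrite /alg_cache service_rcons cache_after_rcons. Qed.

Lemma alg_faults_cat w u : alg_faults k A w <= alg_faults k A (w ++ u).
Proof.
by have [s es _] := service_cat w u; rewrite /alg_faults es nfaults_cat leq_addr.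
Qed.

Lemma OPT_alg_faults w : valid_alg k A -> is_walk w ->
  OPT k (requests w) <= alg_faults k A w.
Proof. by move=> vA ww; rewrite -unzip1_service OPT_le ?vA. Qed.

Lemma alg_faults_cover2 w u1 u2 : k < #|P| -> valid_alg k A -> is_walk w ->
  (forall p, (p \in requests u1) || (p \in requests u2)) ->
  (alg_faults k A w).*2 < alg_faults k A (w ++ u1) + alg_faults k A (w ++ u2).
Proof.
move=> kP vA ww cov.
have [|p pC] := @exists_notin_small _ (alg_cache k A w).
  by apply: leq_ltn_trans kP; apply: card_cache_after; rewrite ?cards0 ?vA.
have [s1 e1 r1] := service_cat w u1; have [s2 e2 r2] := service_cat w u2.
rewrite /alg_faults e1 e2 !nfaults_cat -addnn.
case/orP: (cov p); rewrite -?r1 -?r2 => pr;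
  have := nfaults_gt0 k pC pr; rewrite /alg_cache; lia.
Qed.

End OnlineServices.

(** * Walks on a path, the left order and tours around a vertex *)

Section PathGeometry.
Variables (P : finType) (m : nat) (lab : 'I_m -> P).
Local Notation G := (path_graph lab).
Local Notation step := (fun u v : 'I_m => (u == v) || path_adj u v).

Definition between (i j x : 'I_m) := (i <= x <= j) || (j <= x <= i).

(** A discrete intermediate value theorem: each step moves by at most one. *)
Lemma walk_between (i x : 'I_m) (s : seq 'I_m) :
  path step i s -> between i (last i s) x -> x \in i :: s.
Proof.
elim: s i => [|y s IH] i /=.
  move=> _ H; rewrite inE; apply/eqP/val_inj; move: H; rewrite /between /=; lia.
move=> /andP[iy /IH H] b; rewrite inE; case: eqP => //= xi.
apply: H; move: b iy; have : (x : nat) <> i by move=> /val_inj.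
by rewrite /between /path_adj -val_eqE /=; lia.
Qed.

Lemma prec_between (i : 'I_m) p q :
  (forall j, lab j = q -> exists2 x, between i j x & lab x = p) ->
  @prec P G i p q.
Proof.
move=> H s ps _ /H[x bx lx]; exists x => //.
apply: walk_between bx; apply: sub_path ps => u v /= ->; exact: orbT.
Qed.

Lemma prec_max_between (i : 'I_m) p q : p \in @prec_max P G i ->
  (forall j, lab j = q -> exists2 x, between i j x & lab x = p) -> q = p.
Proof. by rewrite inE => /asboolP H /prec_between; apply: H. Qed.

Lemma exists_walk_between (i j : 'I_m) : exists s : seq 'I_m,
  [/\ path step i s, last i s = j & all (between i j) (i :: s)].
Proof.
(* One of the truncated differences vanishes, so the sum is the distance of i and j. *)
move: {2}(_ + _) (leqnn ((i - j) + (j - i))) => n.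
elim: n i => [|n IH] i Hn.
  exists [::]; split=> //=; first by apply/val_inj => /=; lia.
  by rewrite /between; lia.
have [eij|nij] := eqVneq i j.
  by exists [::]; split=> //=; rewrite /between; lia.
have [y [iy bj Hy]] : exists y : 'I_m, [/\ path_adj i y, between i j y & (y - j) + (j - y) <= n].
  have : (i : nat) != j by rewrite val_eqE.
  case: (ltnP i j) => ij nij'.
    have yP : i.+1 < m by apply: leq_ltn_trans (ltn_ord j).
    by exists (Ordinal yP); rewrite /path_adj /between /=; split; lia.
  have yP : i.-1 < m by apply: leq_ltn_trans (ltn_ord i); lia.
  by exists (Ordinal yP); rewrite /path_adj /between /=; split; lia.
have [s [ps ls bs]] := IH y Hy; exists (y :: s); split=> //.
  by rewrite /= iy orbT.
apply/allP => x; rewrite inE => /predU1P[->|/(allP bs)]; move: bj; rewrite /between; lia.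
Qed.

Lemma detour (i j : 'I_m) : exists s : seq 'I_m,
  [/\ path step i s, last i s = i, all (between i j) s & j \in i :: s].
Proof.
have [s1 [p1 l1 b1]] := exists_walk_between i j.
have [s2 [p2 l2 b2]] := exists_walk_between j i.
exists (s1 ++ s2); rewrite cat_path last_cat l1 p1 l2 p2; split=> //.
  apply/allP => x; rewrite mem_cat => /orP[xs|xs].
    by apply: (allP b1); rewrite inE xs orbT.
  by have := allP b2 x; rewrite inE xs orbT /between orbC => ->.
by rewrite -cat_cons mem_cat -l1 mem_last.
Qed.

(** On a path, a walk from i to j avoiding T exists exactly when the interval between them avoids
    T. *)
Definition reach (i : 'I_m) (T : seq P) (j : 'I_m) :=
  [forall x, between i j x ==> (lab x \notin T)].

(** Concatenate detours from i to all reachable vertices. The tour is closed, so tours can be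
    chained. *)
Lemma tour (i : 'I_m) (T : seq P) : lab i \notin T -> exists u : seq 'I_m,
  [/\ path step i u, last i u = i, {in u, forall x, lab x \notin T} &
      forall j, reach i T j -> j \in u].
Proof.
move=> iT.
suff [u [pu lu au cu]] : exists u : seq 'I_m,
    [/\ path step i u, last i u = i, {in u, forall x, lab x \notin T} &
        {in enum 'I_m, forall j, reach i T j -> j \in u}].
  by exists u; split=> // j; apply: cu; rewrite mem_enum.
elim: (enum 'I_m) => [|j e [u [pu lu au cu]]]; first by exists [::].
case: (boolP (reach i T j)) => rj; last first.
  by exists u; split=> // x; rewrite inE => /predU1P[->|/cu //]; rewrite (negbTE rj).
have [s [ps ls bs js]] := detour i j.
exists ((i :: s) ++ u); rewrite cat_path last_cat /= eqxx ls ps pu lu; split=> //.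
  move=> x; rewrite -cat_cons mem_cat inE -orbA => /or3P[/eqP->//|/(allP bs) b|/au //].
  by move/forallP: rj => /(_ x); rewrite b.
move=> x; rewrite inE -cat_cons mem_cat => /predU1P[->|xe rx]; first by rewrite js.
by rewrite (cu x) ?orbT.
Qed.

Lemma left_before_irr (i : 'I_m) p : left_before lab i p p = false.
Proof.
apply/negbTE/existsP => -[j /and3P[ji /eqP <- /forallP /(_ j)]].
by rewrite leqnn ji eqxx.
Qed.

Lemma left_before_asym (i : 'I_m) p q : left_before lab i p q -> ~~ left_before lab i q p.
Proof.
move=> /existsP[j /and3P[ji /eqP lj /forallP Hj]].
apply/existsP => -[j' /and3P[ji' /eqP lj' /forallP Hj']].
case: (leqP j j') => jj'.
  by have := Hj j'; rewrite jj' ji' lj' eqxx.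
by have := Hj' j; rewrite (ltnW jj') ji lj eqxx.
Qed.

Lemma nearest_left (i : 'I_m) (Q : pred P) : (exists2 j : 'I_m, j <= i & Q (lab j)) ->
  exists j : 'I_m, [/\ j <= i, Q (lab j) & forall x : 'I_m, j < x <= i -> ~~ Q (lab x)].
Proof.
move=> [j0 j0i Qj0].
have H0 : (fun j : 'I_m => (j <= i) && Q (lab j)) j0 by rewrite /= j0i.
have [j /andP[ji Qj] mj] := @arg_maxnP _ j0 (fun j : 'I_m => (j <= i) && Q (lab j)) (@nat_of_ord m) H0.
exists j; split=> // x /andP[jx xi]; apply/negP => Qx.
by have := mj x; rewrite xi Qx => /(_ isT) /=; lia.
Qed.

Lemma nearest_right (i : 'I_m) (Q : pred P) : (exists2 j : 'I_m, i <= j & Q (lab j)) ->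
  exists j : 'I_m, [/\ i <= j, Q (lab j) & forall x : 'I_m, i <= x < j -> ~~ Q (lab x)].
Proof.
move=> [j0 j0i Qj0].
have H0 : (fun j : 'I_m => (i <= j) && Q (lab j)) j0 by rewrite /= j0i.
have [j /andP[ji Qj] mj] := @arg_minnP _ j0 (fun j : 'I_m => (i <= j) && Q (lab j)) (@nat_of_ord m) H0.
exists j; split=> // x /andP[ix xj]; apply/negP => Qx.
by have := mj x; rewrite ix Qx => /(_ isT) /=; lia.
Qed.

Lemma two_sidedP (i : 'I_m) p : p \in prec_max_two_sided lab i ->
  [/\ p \in @prec_max P G i, exists2 j : 'I_m, j < i & lab j = p &
      exists2 j : 'I_m, i < j & lab j = p].
Proof.
rewrite finset.in_set => /and3P[H1 /existsP[j /andP[ji /eqP lj]] /existsP[j' /andP[ji' /eqP lj']]].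
by split=> //; [exists j | exists j'].
Qed.

(** The vertex nearest to i on the left labeled p or q decides; it exists as soon as p occurs
    there. *)
Lemma left_before_total (i : 'I_m) p q :
  (exists2 j : 'I_m, j <= i & lab j = p) -> p != q ->
  left_before lab i p q || left_before lab i q p.
Proof.
move=> [j ji lj] pq.
have [|x [xi Qx Hx]] := @nearest_left i (pred2 p q).
  by exists j; rewrite //= lj eqxx.
have C a b : a != b -> pred2 p q b -> lab x = a -> left_before lab i a b.
  move=> ab Qb lx; apply/existsP; exists x; rewrite xi lx eqxx /=.
  apply/forallP => y; apply/implyP => /andP[xy yi].
  have [->|nxy] := eqVneq y x; first by rewrite lx.
  apply: contraNneq (Hx y _) => [->//|]; rewrite yi andbT ltn_neqAle xy andbT.
  by rewrite eq_sym val_eqE.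
case/orP: Qx => /eqP lx.
  by rewrite (C p q) //= eqxx orbT.
by rewrite (C q p) ?orbT //= ?eqxx // eq_sym.
Qed.

Lemma left_before_visited (i x : 'I_m) (s : seq 'I_m) q :
  path step i s -> last i s = x -> x <= i -> left_before lab i q (lab x) ->
  q \in map lab (i :: s).
Proof.
move=> ps ls xi /existsP[j /and3P[ji /eqP <- /forallP Hj]]; apply: map_f.
apply: (walk_between ps); rewrite ls.
by have := Hj x; rewrite xi eqxx /= andbT implybF -ltnNge /between; lia.
Qed.

(* Were q not visited, every path to q would run through the page of x: on the   *)
(* left by the order hypothesis, on the right because x comes first.             *)
Lemma left_after_visited (i x : 'I_m) (s : seq 'I_m) q :
  path step i s -> last i s = x -> i <= x -> lab x \in @prec_max P G i ->
  left_before lab i (lab x) q -> q \in map lab (i :: s).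
Proof.
move=> ps ls ix xM lb; apply/negPn/negP => qs.
suff e : q = lab x by rewrite e left_before_irr in lb.
apply: (prec_max_between xM) => j lj.
case: (leqP i j) => ij; last first.
  case/existsP: lb => y /and3P[yi /eqP ly /forallP /(_ j)].
  by rewrite lj eqxx => H; exists y => //; move: H; rewrite /between; lia.
exists x => //; rewrite /between ix /=.
case: (leqP x j) => //= xj; case/negP: qs; rewrite -lj; apply: map_f.
by apply: (walk_between ps); rewrite ls /between ij (ltnW xj).
Qed.

(** Every path from i starts at i, so [lab i] precedes all pages. *)
Lemma label_not_max (i : 'I_m) p : 1 < #|P| -> p \in @prec_max P G i -> lab i != p.
Proof.
move=> P2 pM; apply/eqP => ip.
have [q qp] : exists q, q \notin [set p]%SET by apply: exists_notin_small; rewrite cards1.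
case/negP: qp; rewrite inE; apply/eqP/(prec_max_between pM) => j _.
by exists i => //; rewrite /between; lia.
Qed.

(** Each side carries at most one such page: of two pages confined to the same side, the one met
    first from i precedes the other, so the other equals it by maximality. *)
Lemma one_sided_card (i : 'I_m) : (forall p, exists v, lab v = p) -> 1 < #|P| ->
  #|@prec_max P G i :\: prec_max_two_sided lab i| <= 2.
Proof.
move=> lab_surj P2; set N := _ :\: _.
pose f (p : P) := [exists j : 'I_m, (j < i) && (lab j == p)].
have inj : {in N &, injective f}.
  move=> p q; rewrite finset.in_setD => /andP[pM' pM]; rewrite finset.in_setD => /andP[qM' qM] fpq.
  have side r : r \in @prec_max P G i -> r \notin prec_max_two_sided lab i ->
      forall j, lab j = r -> if f r then j < i else i < j.
    move=> rM; rewrite finset.in_set rM /= => rM' j lj.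
    have nij : i != j by apply: contraNneq (label_not_max P2 rM) => ->; rewrite lj.
    have nij' : (i : nat) != j by rewrite val_eqE.
    rewrite /f; case: ifP => [fr|/negbT fr].
      rewrite fr /= in rM'.
      move/existsPn/(_ j): rM'; rewrite lj eqxx andbT; lia.
    move/existsPn/(_ j): fr; rewrite lj eqxx andbT; lia.
  have sp := side _ pM pM'; have sq := side _ qM qM'; rewrite -fpq in sq.
  have [jp ljp] := lab_surj p.
  case: (f p) sp sq => sp sq.
    have [|x [xi Qx Hx]] := @nearest_left i (pred2 p q).
      by exists jp; [exact/ltnW/sp|rewrite /= ljp eqxx].
    case/orP: Qx => /eqP lx.
      apply/esym/(prec_max_between pM) => j lj; exists x => //.
      move: (sq j lj) (Hx j); rewrite /between lj /= eqxx orbT /=; lia.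
    apply/(prec_max_between qM) => j lj; exists x => //.
    move: (sp j lj) (Hx j); rewrite /between lj /= eqxx /=; lia.
  have [|x [xi Qx Hx]] := @nearest_right i (pred2 p q).
    by exists jp; [exact/ltnW/sp|rewrite /= ljp eqxx].
  case/orP: Qx => /eqP lx.
    apply/esym/(prec_max_between pM) => j lj; exists x => //.
    move: (sq j lj) (Hx j); rewrite /between lj /= eqxx orbT /=; lia.
  apply/(prec_max_between qM) => j lj; exists x => //.
  move: (sp j lj) (Hx j); rewrite /between lj /= eqxx /=; lia.
by rewrite -(card_in_imset inj) -card_bool; apply: max_card.
Qed.

(** Otherwise p would lie between i and every occurrence of q. *)
Lemma reach1_cover (i : 'I_m) p q : p \in @prec_max P G i -> q != p ->
  exists2 j, reach i [:: p] j & lab j = q.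
Proof.
move=> pM qp; apply: contrapT => H; case/negP: qp; apply/eqP.
apply: (prec_max_between pM) => j lj.
have : ~~ reach i [:: p] j by apply/negP => rj; apply: H; exists j.
rewrite negb_forall => /existsP[x]; rewrite negb_imply negbK inE => /andP[bx /eqP lx].
by exists x.
Qed.

(* A page q reachable in neither way would lie behind the page of T1 nearest to  *)
(* the right of i, against the maximality of that page.                          *)
Lemma reach2_cover (i : 'I_m) (T1 T2 : seq P) (q : P) :
  {subset T1 <= prec_max_two_sided lab i} -> {subset T2 <= prec_max_two_sided lab i} ->
  T1 != [::] -> T2 != [::] -> allrel (left_before lab i) T1 T2 ->
  exists2 j, reach i T1 j || reach i T2 j & lab j = q.
Proof.
move=> s1 s2 n1 n2 /allrelP lb; apply: contrapT => H.
have [|x1 [ix1 xT1 H1]] := @nearest_right i (mem T1).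
  case: T1 n1 s1 {lb H} => // p T1 _ /(_ p (mem_head _ _)) /two_sidedP[_ _ [j ij lj]].
  by exists j; [exact: ltnW|rewrite lj /= mem_head].
have [|x2 [ix2 xT2 H2]] := @nearest_left i (mem T2).
  case: T2 n2 s2 {lb H} => // p T2 _ /(_ p (mem_head _ _)) /two_sidedP[_ [j ij lj] _].
  by exists j; [exact: ltnW|rewrite lj /= mem_head].
have [pM _ _] := two_sidedP (s1 _ xT1).
have /existsP[y /and3P[yi /eqP ly /forallP Hy]] := lb _ _ xT1 xT2.
have x2y : x2 < y by have := Hy x2; rewrite eqxx ix2 /= andbT implybF -ltnNge.
have ry (j : 'I_m) : x2 < j <= i -> reach i T2 j.
  move=> /andP[x2j ji]; apply/forallP => x; apply/implyP => bx; apply: H2.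
  by move: bx; rewrite /between; lia.
have rx (j : 'I_m) : i <= j < x1 -> reach i T1 j.
  move=> /andP[ij jx]; apply/forallP => x; apply/implyP => bx; apply: H1.
  by move: bx; rewrite /between; lia.
have e : q = lab x1.
  apply: (prec_max_between pM) => j lj; case: (leqP i j) => ij.
    exists x1 => //; rewrite /between ix1 /=; apply/orP; left; rewrite leqNgt.
    by apply/negP => jx; apply: H; exists j; rewrite // rx ?ij.
  exists y => //; rewrite /between yi andbT; apply/orP; right.
  apply: leq_trans (ltnW x2y); rewrite leqNgt.
  by apply/negP => jx; apply: H; exists j; rewrite // ry ?orbT // jx ltnW.
by apply: H; exists y; rewrite ?ly // ry ?orbT // x2y.
Qed.

(** Repeatedly extract the page of S met first on the way left. *)
Lemma left_sorted (i : 'I_m) (S : {set P}) :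
  {in S, forall p, exists2 j : 'I_m, j <= i & lab j = p} ->
  exists t : seq P, [/\ {subset t <= S}, size t = #|S| & pairwise (left_before lab i) t].
Proof.
move: {2}#|S| (erefl #|S|) => n; elim: n S => [|n IH] S Sn HS.
  by exists [::]; split.
have /card_gt0P[p0 p0S] : 0 < #|S| by rewrite Sn.
have [|x [xi xS Hx]] := @nearest_left i (mem S).
  by have [j ji lj] := HS _ p0S; exists j => //=; rewrite lj.
set p := lab x in xS; have {}xS : p \in S := xS.
have [||t [tS st pt]] := IH (S :\ p).
- by move: Sn; rewrite (cardsD1 p) xS => -[].
- by move=> q; rewrite finset.in_setD1 => /andP[_ /HS].
exists (p :: t); split.
- by move=> q; rewrite inE => /predU1P[->//|/tS]; rewrite finset.in_setD1 => /andP[].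
- by rewrite /= st [RHS](cardsD1 p) xS.
rewrite pairwise_cons pt andbT; apply/allP => q /tS.
rewrite finset.in_setD1 => /andP[qp qS]; apply/existsP; exists x; rewrite xi eqxx /=.
apply/forallP => y; apply/implyP => /andP[xy yi].
have [->|nyx] := eqVneq y x; first by rewrite eq_sym.
apply: contraNneq (Hx y _) => [-> //|]; rewrite yi andbT ltn_neqAle xy andbT.
by rewrite eq_sym val_eqE.
Qed.

End PathGeometry.

(** * Phases and the faults they force on every service *)

Section Phases.
Variables (P : finType) (G : ext_access_graph P) (k : nat).
Implicit Types (w : seq (vertex G)).

(** Runs [current_phase] together with a counter of phase changes. *)
Definition phase_state w : seq (vertex G) * nat :=
  foldl (fun st v => (phase_step k st.1 v,
    st.2 + (k < size (undup (requests (rcons st.1 v)))))) ([::], 0) w.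

Definition resets w := (phase_state w).2.

Definition marked w : {set P} := [set p in requests (current_phase k w)]%SET.

Lemma phase_state_rcons w x : phase_state (rcons w x) =
  (phase_step k (phase_state w).1 x,
   (phase_state w).2 + (k < size (undup (requests (rcons (phase_state w).1 x))))).
Proof. by rewrite /phase_state foldl_rcons. Qed.

Lemma current_phase_rcons w x :
  current_phase k (rcons w x) = phase_step k (current_phase k w) x.
Proof. exact: foldl_rcons. Qed.

Lemma phase_state1 w : (phase_state w).1 = current_phase k w.
Proof.
by elim/last_ind: w => // w x IH; rewrite phase_state_rcons current_phase_rcons IH.
Qed.

Lemma size_undup_requests w x :
  size (undup (requests (rcons w x))) = #|label x |: [set p in requests w]%SET|.
Proof.
rewrite -(card_uniqP (undup_uniq _)); apply: eq_card => p.
by rewrite mem_undup /requests map_rcons mem_rcons !inE.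
Qed.

Lemma resets_rcons w x :
  resets (rcons w x) = resets w + (k < #|label x |: marked w|).
Proof. by rewrite /resets phase_state_rcons phase_state1 size_undup_requests. Qed.

Lemma marked_rcons w x : marked (rcons w x) =
  if k < #|label x |: marked w| then [set label x]%SET else label x |: marked w.
Proof.
rewrite /marked current_phase_rcons /phase_step size_undup_requests -/(marked w).
case: ifP => _; apply/finset.setP => p; first by rewrite !inE.
by rewrite /requests map_rcons !inE mem_rcons inE.
Qed.

Lemma card_marked w : 0 < k -> #|marked w| <= k.
Proof.
move=> k0; elim/last_ind: w => [|w x IH].
  have -> : marked [::] = finset.set0 by apply/finset.setP => p; rewrite !inE.
  by rewrite cards0.
by rewrite marked_rcons; case: ltnP => // _; rewrite cards1.
Qed.

Lemma current_phase_walk w x : is_walk (rcons w x) -> exists i s,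
  [/\ current_phase k (rcons w x) = i :: s,
      path (fun u v => (u == v) || adj u v) i s & last i s = x].
Proof.
elim/last_ind: w x => [|w y IH] x ww; rewrite current_phase_rcons /phase_step.
  by exists x, [::]; case: ifP.
case: ifP => _; first by exists x, [::].
have [i [s [-> ps ls]]] : exists i s, [/\ current_phase k (rcons w y) = i :: s,
    path (fun u v => (u == v) || adj u v) i s & last i s = y].
  by apply: IH; move: ww; rewrite /is_walk -[rcons (rcons _ _) x]cats1; case/cat_sorted2.
exists i, (rcons s x); rewrite rcons_cons last_rcons rcons_path ps ls; split=> //=.
move: ww; rewrite /is_walk -cats1; case: w {IH} => [|z w] /=; first by rewrite andbT.
by rewrite cat_path last_rcons /= andbT => /andP[].
Qed.

(* Invariant: a hit leaves [marked :|: cache] unchanged and a fault adds at most *)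
(* one page to it; at a reset this union (with the request) exceeds k pages,     *)
(* while afterwards it is a cache, hence at most k pages.                        *)
Lemma resets_nfaults w s : 0 < k -> unzip1 s = requests w ->
  valid_service k finset.set0 s ->
  resets w + #|marked w :|: cache_after k finset.set0 s| <= nfaults k finset.set0 s /\
  (0 < resets w -> resets w + k <= nfaults k finset.set0 s).
Proof.
move=> k0; elim/last_ind: w s => [|w x IH] s es vs.
  case: s es vs => // _ _; rewrite /resets /= add0n; split=> //.
  by rewrite leqn0 cards_eq0; apply/eqP/finset.setP => p; rewrite !inE.
case/lastP: s es vs => [|s pe].
  by move/(congr1 size); rewrite !size_map size_rcons.
rewrite /unzip1 map_rcons /requests map_rcons => /rcons_inj[es ex].
rewrite -cats1 valid_service_cat /= andbT => /andP[vs v1]; rewrite cats1.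
have {IH} [I1 I2] := IH s es vs.
rewrite nfaults_rcons cache_after_rcons resets_rcons marked_rcons -ex.
set Q := marked w in I1 *; set C := cache_after _ _ _ in v1 I1 *.
have Ck : #|C| <= k by apply: card_cache_after => //; rewrite cards0.
have Ck' := card_serve Ck v1; have yC' := mem_serve k C pe.
case: ltnP => Hk.
  (* The marked pages with the request number more than k. They lie in the union of marked and
     cached pages on a hit; on a fault the request itself pays for the extra page. *)
  have bound : resets w + k.+1 <= nfaults k finset.set0 s + (pe.1 \notin C).
    case: (boolP (pe.1 \in C)) => yC /=.
      rewrite addn0; apply: leq_trans I1; rewrite leq_add2l; apply: leq_trans Hk _.
      apply: subset_leq_card; rewrite finset.subUset finset.sub1set finset.in_setU yC orbT.
      exact: finset.subsetUl.
    have := subset_leq_card (finset.subsetUl Q C).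
    by move: Hk; rewrite cardsU1; case: (_ \notin _); lia.
  split; last by move=> _; lia.
  suff -> : ([set pe.1] :|: serve k C pe)%SET = serve k C pe by lia.
  by apply/finset.setUidPr; rewrite finset.sub1set.
rewrite addn0; split; last by move/I2; lia.
case: (boolP (pe.1 \in C)) => yC /=.
  rewrite addn0 /serve yC; apply: leq_trans I1; rewrite leq_add2l.
  apply: subset_leq_card; rewrite !finset.subUset finset.sub1set finset.in_setU yC orbT.
  by rewrite finset.subsetUl finset.subsetUr.
have : #|pe.1 |: Q :|: serve k C pe| <= (#|Q :|: C|).+1.
  apply: leq_trans (_ : #|pe.1 |: (Q :|: C)| <= _); last by rewrite cardsU1; case: (_ \notin _); lia.
  apply: subset_leq_card; apply/fintype.subsetP => p; rewrite !inE /serve (negbTE yC).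
  by rewrite /=; case: ifP => _; rewrite !inE; case: (p == pe.1);
    case: (p \in requests _); case: (p \in C); rewrite /= ?andbF ?orbT.
by lia.
Qed.

End Phases.

(** * Upper bound: the halving argument for MAXFAR *)

Section MaxfarUpper.
Variables (P : finType) (m k : nat) (lab : 'I_m -> P).
Local Notation G := (path_graph lab).
Local Notation step := (fun u v : 'I_m => (u == v) || path_adj u v).
Local Notation M i := (@prec_max P G i).
Local Notation M' i := (prec_max_two_sided lab i).
Implicit Types (i x : 'I_m) (Q : {set P}) (h : P).

(* The hole (the page outside the cache) is h, the marked pages are Q, and f     *)
(* faults have been made. Each further fault of the phase either halves the      *)
(* unmarked two-sided maximal pages, counted by d, or marks one of the at most   *)
(* two one-sided ones; B bounds the total at the end of the phase.               *)
Definition stage i Q h (f B : nat) : Prop :=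
  [/\ h \in M i, h \notin Q &
   (exists d, [/\ #|[set q in M' i :\: Q | left_before lab i q h]%SET| < 2 ^ d,
      #|[set q in M' i :\: Q | left_before lab i h q]%SET| < 2 ^ d,
      h \in M' i & f + d + 3 <= B]) \/
   (M' i \subset Q /\ f + #|M i :\: Q| <= B)].

Lemma stage_mark i Q Q' h f B :
  stage i Q h f B -> Q \subset Q' -> h \notin Q' -> stage i Q' h f B.
Proof.
move=> [hM hQ H] QQ' hQ'; split=> //.
have sub R : R :\: Q' \subset R :\: Q by apply: finset.setDS.
case: H => [[d [H1 H2 H3 H4]]|[H1 H2]]; [left; exists d; split=> // | right; split].
- apply: leq_ltn_trans H1; apply: subset_leq_card; apply/fintype.subsetP => q.
  by rewrite finset.in_set => /andP[/(fintype.subsetP (sub _)) qM lb]; rewrite finset.in_set qM.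
- apply: leq_ltn_trans H2; apply: subset_leq_card; apply/fintype.subsetP => q.
  by rewrite finset.in_set => /andP[/(fintype.subsetP (sub _)) qM lb]; rewrite finset.in_set qM.
- exact: fintype.subset_trans QQ'.
by apply: leq_trans H2; rewrite leq_add2l subset_leq_card.
Qed.

Lemma stage_le i Q h f B : stage i Q h f B -> f <= B.
Proof. by move=> [_ _ [[d [_ _ _]]|[_]]]; lia. Qed.

Lemma two_sided_sub i : M' i \subset M i.
Proof. by apply/fintype.subsetP => p /two_sidedP[]. Qed.

Lemma maxfar_choice_in i Q h : maxfar_choice lab i (M i :\: Q) h -> h \in M i /\ h \notin Q.
Proof.
rewrite /maxfar_choice; case: ifP => _; first by rewrite finset.in_setD => /andP[].
by move=> /and3P[]; rewrite finset.in_setI finset.in_setD => /andP[/andP[]].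
Qed.

Lemma setI_two_sided i Q : (M i :\: Q) :&: M' i = M' i :\: Q.
Proof.
apply/finset.setP => p; rewrite finset.in_setI !finset.in_setD -andbA; congr (_ && _).
by case: (boolP (p \in M' i)) => [/(fintype.subsetP (two_sided_sub i)) ->|]; rewrite ?andbF.
Qed.

Lemma stage_choice_one_sided i Q h f B : M' i \subset Q ->
  maxfar_choice lab i (M i :\: Q) h -> f + #|M i :\: Q| <= B -> stage i Q h f B.
Proof. by move=> sQ /maxfar_choice_in[hM hQ] fB; split=> //; right. Qed.

Hypothesis lab_surj : forall p, exists v, lab v = p.
Hypothesis P_gt1 : 1 < #|P|.

(** A median leaves less than half of the bound [2 ^ d] on each side, so d drops by one. If no
    two-sided page is left, at most two further faults can follow. *)
Lemma stage_choice i Q h d f B : maxfar_choice lab i (M i :\: Q) h ->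
  #|M' i :\: Q| < 2 ^ d -> f + d + 2 <= B -> stage i Q h f B.
Proof.
move=> ch Sd fB; have [hM hQ] := maxfar_choice_in ch.
have [/eqP S0|Sn0] := boolP (M' i :\: Q == finset.set0).
  have sQ : M' i \subset Q by rewrite -finset.setD_eq0 S0.
  apply: stage_choice_one_sided => //.
  suff : #|M i :\: Q| <= 2 by lia.
  apply: leq_trans (one_sided_card i lab_surj P_gt1).
  by apply/subset_leq_card/finset.setDS.
move: ch; rewrite /maxfar_choice setI_two_sided (negbTE Sn0) /in_middle.
set B1 := [set q in _ | left_before lab i q h]%SET.
set B2 := [set q in _ | left_before lab i h q]%SET.
set S := M' i :\: Q in Sd Sn0 B1 B2 * => /and3P[hS b1 b2].
have S_gt0 : 0 < #|S| by rewrite card_gt0.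
have hM' : h \in M' i by move: hS; rewrite finset.in_setD => /andP[].
have cB : #|B1| + #|B2| < #|S|.
  have dB : [disjoint B1 & B2].
    rewrite -finset.setI_eq0; apply/eqP/finset.setP => q; rewrite finset.in_setI !finset.in_set.
    apply/negP => /andP[/andP[_ l1] /andP[_ l2]].
    by have := left_before_asym l1; rewrite l2.
  have -> : #|B1| + #|B2| = #|B1 :|: B2|.
    by rewrite cardsU (finset.disjoint_setI0 dB) cards0 subn0.
  apply: proper_card; apply/properP; split.
    by apply/fintype.subsetP => q; rewrite finset.in_setU !finset.in_set => /orP[] /andP[].
  by exists h => //; rewrite finset.in_setU !finset.in_set !left_before_irr !andbF.
case: d Sd fB => [|d]; first by rewrite expn0; lia.
(* The two sides sum to at most [2 * 2 ^ d - 2] and differ by at most one, so both are below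
   [2 ^ d]. *)
rewrite expnS => Sd fB; split=> //; left; exists d; rewrite -/S -/B1 -/B2; split=> //; lia.
Qed.

(** If x is left of i, the pages before the hole in the left order have been visited; if right,
    those after it. Either way the unmarked two-sided pages lie on one side of the hole. *)
Lemma stage_fault i x Q Q' s h f B : stage i Q (lab x) f B ->
  path step i s -> last i s = x -> Q \subset Q' -> {subset map lab (i :: s) <= Q'} ->
  maxfar_choice lab i (M i :\: Q') h -> stage i Q' h f.+1 B.
Proof.
move=> [xM xQ H] ps ls QQ' sQ' ch.
have xQ' : lab x \in Q' by apply: sQ'; rewrite -ls; apply: map_f; exact: mem_last.
case: H => [[d [H1 H2 xM' fB]]|[H1 fB]]; last first.
  apply: stage_choice_one_sided ch _; first exact: fintype.subset_trans QQ'.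
  suff : #|M i :\: Q'| < #|M i :\: Q| by lia.
  apply: proper_card; apply/properP; split; first exact: finset.setDS.
  by exists (lab x); rewrite finset.in_setD ?xQ // xQ'.
apply: (stage_choice (d := d)) ch _ _; last by lia.
have sub : M' i :\: Q' \subset M' i :\: Q by apply: finset.setDS.
case: (leqP x i) => xi.
  apply: leq_ltn_trans H2; apply: subset_leq_card; apply/fintype.subsetP => q qS.
  rewrite finset.in_set (fintype.subsetP sub) //=.
  move: qS; rewrite finset.in_setD => /andP[qQ' qM'].
  have qx : q != lab x by apply: contraNneq qQ' => ->.
  have [_ [j ji lj] _] := two_sidedP qM'.
  case/orP: (left_before_total (ex_intro2 _ _ j (ltnW ji) lj) qx) => // lb.
  by case/negP: qQ'; apply: sQ'; apply: left_before_visited ps ls xi lb.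
apply: leq_ltn_trans H1; apply: subset_leq_card; apply/fintype.subsetP => q qS.
rewrite finset.in_set (fintype.subsetP sub) //=.
move: qS; rewrite finset.in_setD => /andP[qQ' qM'].
have qx : q != lab x by apply: contraNneq qQ' => ->.
have [_ [j ji lj] _] := two_sidedP qM'.
case/orP: (left_before_total (ex_intro2 _ _ j (ltnW ji) lj) qx) => // lb.
by case/negP: qQ'; apply: sQ'; apply: left_after_visited ps ls (ltnW xi) xM lb.
Qed.

Variables (A : online_alg G) (L : nat).
Hypothesis k_gt0 : 0 < k.
Hypothesis P_card : #|P| = k.+1.
Hypothesis A_maxfar : is_maxfar k A.
Hypothesis two_sided_small : forall i, #|M' i| < 2 ^ L.+1.

(** In the first phase the cache is the marked set and there may be no unique hole. Later the budget
    is k for that phase and [L + 4] for each following one. *)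
Definition maxfar_inv (w : seq 'I_m) : Prop :=
  (resets k (w : seq (vertex G)) = 0 /\
    alg_cache k A w = marked k (w : seq (vertex G)) /\
    alg_faults k A w = #|marked k (w : seq (vertex G))|) \/
  (0 < resets k (w : seq (vertex G)) /\ exists i s h,
    [/\ @current_phase P G k w = i :: s, alg_cache k A w = [set~ h]%SET &
        stage i (marked k (w : seq (vertex G))) h (alg_faults k A w)
          (k + (L + 4) * resets k (w : seq (vertex G)))]).

Lemma maxfar_evicts (w : seq 'I_m) (x : 'I_m) i s :
  is_walk (rcons w x : seq (vertex G)) ->
  lab x \notin alg_cache k A w -> k <= #|alg_cache k A w| ->
  @current_phase P G k (rcons w x) = i :: s ->
  maxfar_choice lab i (M i :\: marked k (rcons w x : seq (vertex G))) (A (rcons w x)) /\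
  alg_cache k A (rcons w x) = [set~ A (rcons w x)]%SET.
Proof.
move=> ww xC Ck cp; have [vA] := A_maxfar; move=> /(_ w x ww xC Ck); rewrite cp /=.
set N := [set _ in _ | _]%SET; set N' := M i :\: _.
have -> : N = N' by apply/finset.setP => p; rewrite /N /N' /marked cp finset.in_setD !finset.in_set andbC.
move=> ch; split=> //; set e := A _ in ch *.
have [_ eQ] := maxfar_choice_in ch.
have xQ : lab x \in marked k (rcons w x : seq (vertex G)).
  rewrite marked_rcons /=; case: ifP => _; first by rewrite finset.in_set1.
  by rewrite finset.setU11.
have Cx : alg_cache k A w = [set~ lab x]%SET.
  apply/eqP; rewrite eqEcard cardsC1 P_card Ck andbT; apply/fintype.subsetP => p pC.
  by rewrite finset.in_setC1; apply: contraNneq xC => <-.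
rewrite alg_cache_rcons /serve /= (negbTE xC) ltnNge Ck /= -/e Cx.
apply/finset.setP => p; rewrite !inE.
case: (p =P lab x) => [->|_] /=; last by rewrite andbT.
by apply/esym; apply: contraNneq eQ => <-.
Qed.

Lemma maxfar_invariant (w : seq 'I_m) : is_walk (w : seq (vertex G)) -> maxfar_inv w.
Proof.
elim/last_ind: w => [|w x IH] ww.
  left; split=> //; split; first by apply/finset.setP => p; rewrite !inE.
  by apply/esym/eqP; rewrite cards_eq0; apply/eqP/finset.setP => p; rewrite !inE.
have {IH} I : maxfar_inv w.
  by apply: IH; move: ww; rewrite /is_walk -cats1; case/cat_sorted2.
have [i [s [cp ps ls]]] := @current_phase_walk P G k w x ww.
have mk : #|marked k (w : seq (vertex G))| <= k by apply: card_marked.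
have re := @resets_rcons P G k w x; have me := @marked_rcons P G k w x.
have fe := @alg_faults_rcons P G k A w x.
have phx : @current_phase P G k (rcons w x) =
    if k < #|lab x |: marked k (w : seq (vertex G))| then [:: x]
    else rcons (@current_phase P G k w) x.
  by rewrite current_phase_rcons /phase_step size_undup_requests.
(* A new phase opens with a fault; with d = [L.+1] it needs 1 + (L + 1) + 2 = L + 4 units of
   budget. *)
have start : lab x \notin alg_cache k A w -> k <= #|alg_cache k A w| ->
    k < #|lab x |: marked k (w : seq (vertex G))| ->
    alg_faults k A w <= k + (L + 4) * resets k (w : seq (vertex G)) ->
    maxfar_inv (rcons w x).
  move=> xC Ck r fB; have [ch ca] := maxfar_evicts ww xC Ck cp.
  right; rewrite re r addn1; split=> //; exists i, s, (A (rcons w x)); split=> //.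
  apply: (stage_choice (d := L.+1)) ch _ _.
    by apply: leq_ltn_trans (two_sided_small i); apply/subset_leq_card/finset.subsetDl.
  by rewrite fe xC mulnS; lia.
case: I => [[r0 [ca fa]]|[r_gt0 [i0 [s0 [h [cp0 ca st]]]]]].
  case: (boolP (lab x \in marked k (w : seq (vertex G)))) => xQ.
    have mU : lab x |: marked k (w : seq (vertex G)) = marked k (w : seq (vertex G)).
      by apply/finset.setUidPr; rewrite finset.sub1set.
    left; rewrite re me /= mU ltnNge mk /= fe ca xQ /= r0 fa !addn0; do 2!split=> //.
    by rewrite alg_cache_rcons /serve ca xQ.
  have cU : #|lab x |: marked k (w : seq (vertex G))| = #|marked k (w : seq (vertex G))|.+1.
    by rewrite cardsU1 xQ.
  case: (ltnP #|marked k (w : seq (vertex G))| k) => Hk; last first.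
    apply: start; rewrite ?ca ?cU ?ltnS //; rewrite fa r0; lia.
  left; rewrite re me /= cU ltnS leqNgt Hk /= fe ca xQ /= r0 fa addn1 addn0; do 2!split=> //.
  by rewrite alg_cache_rcons /serve ca (negbTE xQ) Hk.
have [hM hQ _] := st.
have cf : #|alg_cache k A w| = k by rewrite ca cardsC1 P_card.
case: (ltnP k #|lab x |: marked k (w : seq (vertex G))|) => Hk.
  (* The hole is unmarked, so a request to another page would leave at most k distinct pages in the
     phase. *)
  have xh : lab x = h.
    apply/eqP; apply: contraTT Hk => xh; rewrite -leqNgt.
    have := subset_leq_card (_ : lab x |: marked k (w : seq (vertex G)) \subset [set~ h]%SET).
    rewrite cardsC1 P_card; apply; apply/fintype.subsetP => p; rewrite finset.in_setU1 finset.in_setC1.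
    by move=> /predU1P[->//|pQ]; apply: contraNneq hQ => <-.
  by apply: start; rewrite ?cf ?ca ?(stage_le st) // xh finset.in_setC1 eqxx.
move: phx; rewrite ltnNge Hk /= cp0 cp rcons_cons => -[ei es]; subst i0.
rewrite ltnNge Hk /= in me; rewrite ltnNge Hk /= addn0 in re.
have QQ' : marked k (w : seq (vertex G)) \subset marked k (rcons w x : seq (vertex G)).
  by rewrite me; apply: finset.subsetUr.
case: (eqVneq (lab x) h) => xh; last first.
  have xC : lab x \in alg_cache k A w by rewrite ca finset.in_setC1.
  right; rewrite re; split=> //; exists i, s, h; split=> //.
    by rewrite alg_cache_rcons /serve xC.
  rewrite fe xC addn0; apply: stage_mark st QQ' _.
  by rewrite me finset.in_setU1 negb_or eq_sym xh.
have xC : lab x \notin alg_cache k A w by rewrite ca finset.in_setC1 xh eqxx.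
have [ch ca'] := maxfar_evicts ww xC (eq_leq (esym cf)) cp.
right; rewrite re; split=> //; exists i, s, (A (rcons w x)); split=> //.
rewrite fe xC addn1; rewrite -xh in st.
apply: stage_fault st ps ls QQ' _ ch => p; rewrite /marked cp finset.in_set //.
Qed.

Lemma maxfar_upper (w : seq 'I_m) : is_walk (w : seq (vertex G)) ->
  alg_faults k A w <= (L + 4) * OPT k (@requests P G w).
Proof.
move=> ww.
suff [n nO Hn] : exists2 n, n <= OPT k (@requests P G w) & alg_faults k A w <= (L + 4) * n.
  by apply: leq_trans Hn _; rewrite leq_mul2l nO orbT.
have fs : alg_faults k A w <= size (@requests P G w).
  by rewrite -(unzip1_service A w) size_map; apply: nfaults_size.
have [vA _] := A_maxfar.
case: (maxfar_invariant ww) => [[r0 [ca fa]]|[r_gt0 [i [s [h [_ _ /stage_le fB]]]]]].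
  exists (alg_faults k A w); last by rewrite mulnDl; lia.
  apply: OPT_ge => // t et vt; have [H _] := @resets_nfaults P G k w t k_gt0 et vt.
  apply: leq_trans H; rewrite fa r0 add0n; apply/subset_leq_card/finset.subsetUl.
exists (resets k (w : seq (vertex G)) + k); last first.
  rewrite mulnDr; set X := _ * resets _ _ in fB *.
  by apply: leq_trans fB _; rewrite addnC leq_add2l mulnDl; lia.
apply: OPT_ge => [|t et vt]; last by have [_ ->] := @resets_nfaults P G k w t k_gt0 et vt.
apply: leq_trans fs.
by have [_ ->] := @resets_nfaults P G k w _ k_gt0 (unzip1_service A w) (vA _ ww).
Qed.

End MaxfarUpper.

(** * Expected faults of a randomized algorithm *)

Section RandomFaults.
Variables (R : realType) (P : finType) (G : ext_access_graph P) (k : nat).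
Variable A : rand_alg G k R.
Local Open Scope ring_scope.
Implicit Types (w u : seq (vertex G)).
Local Notation run := (@rand_run _ _ _ _ A).
Local Notation T := (rand_space A).
Local Notation faults w := (fun omega : T => (alg_faults k (run omega) w)%:R : R).

Lemma measurable_runs (ws : seq (seq (vertex G))) (t : seq P) :
  measurable ([set omega | map (run omega) ws = t]%classic : set T).
Proof.
elim: ws t => [|w ws IH] [|p t] /=.
- by rewrite (_ : [set _ | _]%classic = setT) //; apply/seteqP; split.
- by rewrite (_ : [set _ | _]%classic = set0) //; apply/seteqP; split.
- by rewrite (_ : [set _ | _]%classic = set0) //; apply/seteqP; split.
rewrite (_ : [set _ | _]%classic = ([set omega | run omega w = p] `&`
    [set omega | map (run omega) ws = t])%classic).
  by apply: measurableI => //; apply: rand_meas.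
by apply/seteqP; split => omega /= [-> ->].
Qed.

(** The count depends only on the finitely many evictions at prefixes of w, so a preimage is a
    finite union of measurable events. *)
Lemma measurable_faults w : measurable_fun setT (faults w).
Proof.
move=> _ Y mY; rewrite setTI.
pose ws := [seq take i.+1 w | i <- iota 0 (size w)].
pose g (t : seq P) : R := (nfaults k finset.set0 (zip (requests w) t))%:R.
rewrite (_ : _ @^-1` _ = \bigcup_(t in [set t : (size ws).-tuple P | Y (g t)])
    [set omega | map (run omega) ws = t])%classic.
  by apply: fin_bigcup_measurable => [|t _]; [exact: finite_finset|exact: measurable_runs].
have gE omega : faults w omega = g (map (run omega) ws).
  by rewrite /g /ws -map_comp.
apply/seteqP; split=> omega.
  rewrite /preimage /= gE => Yg.
  have sz : size (map (run omega) ws) == size ws by rewrite size_map.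
  by exists (Tuple sz).
by move=> [t /= Yt e]; rewrite gE e.
Qed.

Definition exp_faults w : R := fine (rand_faults A w).

Let mEF w : measurable_fun setT (fun x : T => (faults w x)%:E : \bar R).
Proof. exact/measurable_EFinP/measurable_faults. Qed.

Let rand_faultsE w : rand_faults A w = (\int[rand_prob A]_x (faults w x)%:E)%E.
Proof. by rewrite /rand_faults unlock. Qed.

Let int_cst (r : R) : (\int[rand_prob A]_x r%:E)%E = r%:E.
Proof. by have := expectation_cst (rand_prob A) r; rewrite unlock. Qed.

Lemma exp_faultsE w : rand_faults A w = (exp_faults w)%:E.
Proof.
rewrite /exp_faults fineK // ge0_fin_numE; last by apply: expectation_ge0 => x; exact: ler0n.
apply: le_lt_trans (ltry (size w)%:R).
rewrite -(int_cst (size w)%:R) rand_faultsE; apply: ge0_le_integral => //.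
move=> x _; rewrite lee_fin ler_nat.
by apply: leq_trans (nfaults_size _ _ _) _; rewrite -(size_map fst) -/(unzip1 _) unzip1_service size_map.
Qed.

Lemma exp_faults_ge (n : nat) w : (forall omega, (n <= alg_faults k (run omega) w)%N) ->
  n%:R <= exp_faults w.
Proof.
move=> H; rewrite -lee_fin -exp_faultsE rand_faultsE -(int_cst n%:R).
by apply: ge0_le_integral => // x _; rewrite lee_fin ?ler0n // ler_nat.
Qed.

Lemma exp_faults_cat w u : exp_faults w <= exp_faults (w ++ u).
Proof.
rewrite -lee_fin -!exp_faultsE !rand_faultsE.
by apply: ge0_le_integral => // x _; rewrite lee_fin ?ler0n // ler_nat alg_faults_cat.
Qed.

(** Integrates [alg_faults_cover2], whose strict inequality between naturals supplies the 1. *)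
Lemma exp_faults_cover2 w u1 u2 : (k < #|P|)%N -> is_walk w ->
  (forall p, (p \in requests u1) || (p \in requests u2)) ->
  exp_faults w *+ 2 + 1 <= exp_faults (w ++ u1) + exp_faults (w ++ u2).
Proof.
move=> kP ww cov; rewrite mulr2n -lee_fin !EFinD -!exp_faultsE !rand_faultsE.
have ge0 v (x : T) : setT x -> (0 <= (faults v x)%:E)%E by rewrite lee_fin ler0n.
rewrite -(int_cst 1) -!ge0_integralD //; last 2 first.
- by move=> x _; rewrite adde_ge0 // lee_fin ler0n.
- exact: emeasurable_funD.
apply: ge0_le_integral => //.
- by move=> x _; rewrite -!EFinD lee_fin !addr_ge0 ?ler0n.
- by do 2?apply: emeasurable_funD.
- exact: emeasurable_funD.
move=> x _; rewrite -!EFinD lee_fin -!natrD -[1]/(1%:R) -natrD ler_nat.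
by rewrite addnn addn1; apply: alg_faults_cover2 => //; apply: rand_valid.
Qed.

End RandomFaults.

(** * Lower bound: the binary search adversary *)

Section Adversary.
Variables (R : realType) (P : finType) (m k : nat) (lab : 'I_m -> P).
Local Notation G := (path_graph lab).
Local Notation step := (fun u v : 'I_m => (u == v) || path_adj u v).
Local Notation M' i := (prec_max_two_sided lab i).
Variable A : rand_alg G k R.
Local Notation E := (@exp_faults R P G k A).
Hypothesis k_gt0 : 0 < k.
Hypothesis P_card : #|P| = k.+1.
Hypothesis lab_surj : forall p, exists v, lab v = p.
Implicit Types (i : 'I_m) (u v : seq 'I_m).

Let P_gt1 : 1 < #|P|. Proof. by rewrite P_card ltnS. Qed.

Lemma label_notin i (T : seq P) : {subset T <= M' i} -> lab i \notin T.
Proof.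
move=> TM; apply/negP => /TM /two_sidedP[iM _ _].
by have := label_not_max P_gt1 iM; rewrite eqxx.
Qed.

Lemma tour1 i p : p \in @prec_max P G i -> exists u : seq 'I_m,
  [/\ path step i u, last i u = i, p \notin @requests P G u &
      forall q, q != p -> q \in @requests P G u].
Proof.
move=> pM; have [|u [pu lu au cu]] := @tour P m lab i [:: p].
  by rewrite inE label_not_max.
exists u; split=> //.
  by apply/mapP => -[x /au xp e]; move: xp; rewrite inE -[lab x]e eqxx.
by move=> q /(reach1_cover pM)[j /cu ju <-]; apply: (map_f lab).
Qed.

(* Split T into its left and right halves. Tours avoiding either half jointly    *)
(* request every page, so one of the two hits the hole with probability at least *)
(* 1/2; continue with the half that this tour avoided.                           *)
Lemma round i d v (T : seq P) : path step i v -> last i v = i ->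
  {subset T <= M' i} -> pairwise (left_before lab i) T -> 2 ^ d <= size T ->
  exists u p, [/\ path step i u /\ last i u = i, p \in T,
     p \notin @requests P G u, forall q, q != p -> q \in @requests P G u &
     (E (i :: v) + d%:R / 2 <= E (i :: v ++ u))%R].
Proof.
elim: d v T => [|d IH] v T pv lv TM pw sT.
  (* The search ends with a tour that requests every page but p, so that offline the hole can rest
     at p. *)
  case: T TM pw sT => // p T TM _ _.
  have [pM _ _] := two_sidedP (TM p (mem_head _ _)).
  have [u [pu lu pnu cu]] := tour1 pM; exists u, p; split=> //; first exact: mem_head.
  by rewrite mul0r addr0; apply: (@exp_faults_cat _ _ _ _ A (i :: v)).
move: pw; rewrite -(cat_take_drop (2 ^ d) T) pairwise_cat => /and3P[lb pw1 pw2].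
have TM1 : {subset take (2 ^ d) T <= M' i} by move=> q /mem_take /TM.
have TM2 : {subset drop (2 ^ d) T <= M' i} by move=> q /mem_drop /TM.
rewrite expnS in sT; have d_gt0 : 0 < 2 ^ d by rewrite expn_gt0.
have s1 : 2 ^ d <= size (take (2 ^ d) T) by rewrite size_takel //; lia.
have s2 : 2 ^ d <= size (drop (2 ^ d) T) by rewrite size_drop; lia.
have [u1 [pu1 lu1 au1 cu1]] := tour (label_notin TM1).
have [u2 [pu2 lu2 au2 cu2]] := tour (label_notin TM2).
have half : (E (i :: v) + 1 / 2 <= E (i :: v ++ u1))%R \/
            (E (i :: v) + 1 / 2 <= E (i :: v ++ u2))%R.
  have := @exp_faults_cover2 R P G k A (i :: v) u1 u2.
  rewrite P_card ltnS leqnn => /(_ isT pv) H.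
  have {H} : (E (i :: v) *+ 2 + 1 <= E (i :: v ++ u1) + E (i :: v ++ u2))%R.
    apply: H => q.
    have [||j r <-] := reach2_cover q TM1 TM2 _ _ lb.
    - by rewrite -size_eq0 -lt0n (leq_trans d_gt0 s1).
    - by rewrite -size_eq0 -lt0n (leq_trans d_gt0 s2).
    by case/orP: r => [/cu1|/cu2] ju; apply/orP; [left|right]; apply: (map_f lab).
  case: (lerP (E (i :: v) + 1 / 2) (E (i :: v ++ u1))) => [|H1 H2]; first by left.
  by right; lra.
(* The final page p is found in T', which the tour u' avoided, so the whole round avoids p. *)
have finish u' T' : {subset T' <= T} -> {subset T' <= M' i} ->
    pairwise (left_before lab i) T' ->
    2 ^ d <= size T' -> path step i u' -> last i u' = i ->
    {in u', forall x, lab x \notin T'} -> (E (i :: v) + 1 / 2 <= E (i :: v ++ u'))%R ->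
    exists u p, [/\ path step i u /\ last i u = i, p \in T,
     p \notin @requests P G u, forall q, q != p -> q \in @requests P G u &
     (E (i :: v) + d.+1%:R / 2 <= E (i :: v ++ u))%R].
  move=> T'T T'M pw' sT' pu' lu' au' g.
  have [|||||u [p [[pu lu] pT pnu cu H]]] := IH (v ++ u') T' => //.
  - by rewrite cat_path pv lv.
  - by rewrite last_cat lv.
  exists (u' ++ u), p; split.
  - by rewrite cat_path last_cat pu' lu'.
  - exact: T'T.
  - rewrite /requests map_cat mem_cat negb_or pnu andbT.
    by apply/mapP => -[x /au' xT' e]; move: xT'; rewrite -[lab x]e pT.
  - by move=> q /cu qu; rewrite /requests map_cat mem_cat qu orbT.
  rewrite catA; apply: le_trans H; rewrite -natr1; lra.
rewrite cat_take_drop; case: half => g.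
- by apply: (finish u1 (take (2 ^ d) T)) => // q; apply: mem_take.
- by apply: (finish u2 (drop (2 ^ d) T)) => // q; apply: mem_drop.
Qed.

(* Offline, evict the target page of a round when the hole is requested in that  *)
(* round: at most one fault per round.                                           *)
Lemma rounds i d n : 2 ^ d <= #|M' i| -> exists v,
  [/\ is_walk (i :: v : seq (vertex G)), OPT k (@requests P G (i :: v)) <= n + k &
      (n%:R * (d%:R / 2) <= E (i :: v))%R].
Proof.
move=> dM; have [|T [TM sT pw]] := @left_sorted P m lab i (M' i).
  by move=> p /two_sidedP[_ [j ji lj] _]; exists j => //; apply: ltnW.
suff [v [s [q [pv lv]]]] : exists v s q, [/\ path step i v, last i v = i,
    unzip1 s = @requests P G (i :: v) /\ valid_service k finset.set0 s,
    cache_after k finset.set0 s = [set~ q]%SET /\ nfaults k finset.set0 s <= n + k &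
    (n%:R * (d%:R / 2) <= E (i :: v))%R].
  move=> [es vs] [_ fs] H; exists v; split=> //.
  by rewrite -es; apply: leq_trans (OPT_le vs) fs.
elim: n => [|n [v [s [q [pv lv [es vs] [cs fs] En]]]]].
  (* An initial tour fills the cache with all pages but p; its at most k faults are the k in the
     bound. *)
  have /card_gt0P[p /two_sidedP[pM _ _]] : 0 < #|M' i| by apply: leq_trans dM; rewrite expn_gt0.
  have [u [pu lu pnu cu]] := tour1 pM.
  exists u, [seq (lab x, p) | x <- i :: u], p.
  have es : unzip1 [seq (lab x, p) | x <- i :: u] = @requests P G (i :: u).
    by rewrite /unzip1 -map_comp.
  have pn : p \notin @requests P G (i :: u).
    by rewrite inE negb_or pnu andbT eq_sym label_not_max.
  have [||vs fs cs] := @serve_avoiding P k finset.set0 [seq (lab x, p) | x <- i :: u] p P_card.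
  - exact: finset.sub0set.
  - by rewrite es.
  split=> //.
  - split; last by move: fs; rewrite cards0 addn0.
    rewrite cs es finset.set0U; apply/finset.setP => q; rewrite finset.in_set finset.in_setC1.
    case: (eqVneq q p) => [->|/cu qu]; first exact/negbTE.
    by rewrite inE qu orbT.
  by rewrite mul0r; apply: (@exp_faults_ge _ _ _ _ A 0).
have [u [p [[pu lu] pT pnu cu H]]] := round pv lv TM pw (leq_trans dM (eq_leq (esym sT))).
pose t := [seq (lab x, p) | x <- u].
have et : unzip1 t = @requests P G u by rewrite /unzip1 -map_comp.
have [|||vt ft ct] := @serve_hole P k t q p P_card.
- by rewrite et.
- by rewrite et; case: eqVneq => //= /cu.
- by move=> x /mapP[y _ ->].
exists (v ++ u), (s ++ t), p; split.
- by rewrite cat_path pv lv.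
- by rewrite last_cat lv.
- by rewrite /unzip1 map_cat -/(unzip1 s) -/(unzip1 t) es et -map_cat valid_service_cat vs cs vt.
- by rewrite cache_after_cat nfaults_cat cs ct; split=> //; lia.
apply: le_trans H; rewrite -natr1; lra.
Qed.

(** Each tour that avoids nothing requests all pages and costs one more fault. *)
Lemma OPT_unbounded (i : 'I_m) n : exists v,
  [/\ is_walk (i :: v : seq (vertex G)) & n <= OPT k (@requests P G (i :: v))].
Proof.
suff [v [pv _ nv]] : exists v, [/\ path step i v, last i v = i & n <= OPT k (@requests P G (i :: v))].
  by exists v.
elim: n => [|n [v [pv lv nv]]]; first by exists [::].
have [//|u [pu lu _ cu]] := @tour P m lab i [::].
exists (v ++ u); rewrite cat_path last_cat pv lv; split=> //.
apply: (leq_ltn_trans nv); rewrite -cat_cons /requests map_cat.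
apply: OPT_cat_cover; first by rewrite P_card.
move=> p; have [j <-] := lab_surj p; apply: map_f; apply: cu.
by apply/forallP => x; rewrite implybT.
Qed.

End Adversary.

(** * From fault counts to competitive ratios *)

Local Open Scope ring_scope.

Lemma natmul_bounded_le0 (R : realType) (a c : R) :
  (forall n : nat, n%:R * a <= c) -> a <= 0.
Proof.
move=> H; rewrite leNgt; apply/negP => a_gt0.
have := H (Num.Def.archi_bound `|c / a|); rewrite leNgt => /negP; apply.
by rewrite -ltr_pdivrMr // (le_lt_trans (ler_norm _)) // archi_boundP.
Qed.

Section RatioBounds.
Variables (R : realType) (P : finType) (m k : nat) (lab : 'I_m -> P).
Local Notation G := (path_graph lab).
Local Notation M' i := (prec_max_two_sided lab i).
Hypothesis k_gt0 : (0 < k)%N.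
Hypothesis P_card : #|P| = k.+1.
Hypothesis lab_surj : forall p, exists v, lab v = p.

(** After n rounds n d/2 is at most r (n + k) + C for all n, hence d/2 is at most r. The alternative
    [d = 0] covers paths where no vertex has a two-sided maximal page. *)
Lemma rand_ratio_ge (A : rand_alg G k R) (i : 'I_m) (d : nat) (r C : R) :
  (2 ^ d <= #|M' i|)%N \/ d = 0%N ->
  (forall w, is_walk w ->
     (rand_faults A w <= (r * (OPT k (requests w))%:R + C)%:E)%E) ->
  1 <= r /\ d%:R / 2 <= r.
Proof.
move=> dM H.
have {}H w : is_walk w -> exp_faults A w <= r * (OPT k (requests w))%:R + C.
  by move=> /H; rewrite exp_faultsE lee_fin.
have r_ge1 : 1 <= r.
  rewrite -subr_le0; apply: (@natmul_bounded_le0 _ _ `|C|) => n.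
  have [v [wv nO]] := OPT_unbounded P_card lab_surj i n.
  have HO : (OPT k (@requests P G (i :: v)))%:R * (1 - r) <= `|C|.
    have E1 : (OPT k (@requests P G (i :: v)))%:R <= exp_faults A (i :: v).
      by apply: exp_faults_ge => omega; apply: OPT_alg_faults => //; apply: rand_valid.
    by have := le_trans E1 (H _ wv); have := ler_norm C; lra.
  have [r1|r1] := lerP (1 - r) 0; first by rewrite (le_trans (mulr_ge0_le0 _ r1)).
  by apply: le_trans HO; rewrite ler_pM2r // ler_nat.
split=> //; case: dM => [dM|->]; last by rewrite mul0r (le_trans ler01).
rewrite -subr_le0; apply: (@natmul_bounded_le0 _ _ (r * k%:R + C)) => n.
have [v [wv nO En]] := rounds A k_gt0 P_card n dM.
have := le_trans En (H _ wv).
have : r * (OPT k (@requests P G (i :: v)))%:R <= r * (n%:R + k%:R).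
  by rewrite ler_wpM2l ?(le_trans ler01) // -natrD ler_nat.
lra.
Qed.

End RatioBounds.

Theorem mainTheorem5 (R : realType) :
  exists b : R, 0 < b /\
    forall (k : nat) (P : finType) (m : nat) (lab : 'I_m -> P)
           (A : online_alg (path_graph lab)),
      (1 <= k)%N ->
      #|P| = k.+1 ->
      (forall p : P, exists v : 'I_m, lab v = p) ->
      is_maxfar k A ->
      (r_det k R A <= b%:E * r_obl_infty (path_graph lab) k R)%E.
Proof.
exists 6; split=> // k P m lab A k_gt0 P_card lab_surj A_maxfar.
have /card_gt0P[p0 _] : (0 < #|P|)%N by rewrite P_card.
have [i0 _] := lab_surj p0.
pose f i := #|prec_max_two_sided lab i|.
have [i _ i_max] := @arg_maxnP _ i0 xpredT f isT.
pose L := trunc_log 2 (f i).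
have upper : (r_det k R A <= (L + 4)%:R%:E)%E.
  apply: ereal_inf_lbound; exists (L + 4)%:R => // w ww.
  rewrite lee_fin -natrM ler_nat; apply: maxfar_upper => // [|j].
    by rewrite P_card ltnS.
  by apply: leq_ltn_trans (i_max j isT) _; apply: trunc_log_ltn.
apply: le_trans upper _.
have lower : (((L + 4)%:R / 6 : R)%:E <= r_obl_infty (path_graph lab) k R)%E.
  apply/ereal_infP => _ [B ->]; apply/ereal_infP => _ [r [C [_ HC]] <-].
  have dM : (2 ^ L <= #|prec_max_two_sided lab i|)%N \/ L = 0%N.
    have [f0|f_gt0] := posnP (f i); first by right; rewrite /L f0.
    by left; apply: trunc_logP.
  have [r1 r2] := rand_ratio_ge k_gt0 P_card lab_surj dM HC.
  (* (L + 4)/6 is at most 1 for L up to 2 and at most L/2 from 2 on. *)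
  by rewrite lee_fin natrD; lra.
rewrite (_ : (L + 4)%:R%:E = 6%:E * ((L + 4)%:R / 6 : R)%:E)%E; last first.
  by rewrite -EFinM mulrC divfK.
by apply: lee_wpmul2l.
Qed.
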